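(* Let $(U,\mu)$ be a fuzzy Hilbert space (satisfying the standing assumptions in the context), let $K_1,K_2$ be strongly fuzzy bounded linear operators on $U$, and let $\{f_i\}_{i=1}^\infty$ be a fuzzy $K_1$-frame for $U$. Suppose $\lambda_1,\lambda_2\ge0$ with $\lambda_2<1$ are such that $$\|(K_1^*-K_2^* )f\|_\alpha\le\lambda_1\|K_1^*f\|_\alpha+\lambda_2\|K_2^*f\|_\alpha$$ for all $f\in U$ and all $\alpha\in(0,1)$. Then $\{f_i\}_{i=1}^\infty$ is a fuzzy $K_2$-frame for $U$.
   Context: Let $U$ be a complex vector space with zero vector $\theta$. A fuzzy inner product on $U$ is a map $\mu:U\times U\times\mathbb C\to[0,1]$ such that for all $x,y,z\in U$, $s,t\in\mathbb C$: (FIP1) $\mu(x+y,z,|t|+|s|)\ge\min\{\mu(x,z,|t|),\mu(y,z,|s|)\}$; (FIP2) $\mu(x,y,|st|)\ge\min\{\mu(x,x,|s|^2),\mu(y,y,|t|^2)\}$; (FIP3) $\mu(x,y,t)=\mu(y,x,\overline t)$; (FIP4) $\mu(cx,y,t)=\mu(x,y,t/|c|)$ for $c\in\mathbb C\setminus\{0\}$; (FIP5) $\mu(x,x,t)=0$ for $t\in\mathbb C\setminus\mathbb R^+$; (FIP6) $\mu(x,x,t)=1$ for all $t>0$ iff $x=\theta$; (FIP7) $\mu(x,x,\cdot):\mathbb R\to[0,1]$ is non-decreasing with limit $1$ at $+\infty$. Put $N(x,t)=\mu(x,x,t^2)$ for $t>0$ and $N(x,t)=0$ for real $t\le0$. Standing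 assumptions: (FIP8) if $\mu(x,x,t^2)>0$ for all $t>0$ then $x=\theta$; (FIP9) the norms $\|x\|_\alpha=\inf\{t>0:N(x,t)\ge\alpha\}$, $\alpha\in(0,1)$ (the $\alpha$-norms, an ascending family of norms on $U$), satisfy the parallelogram law. Let $\langle\cdot,\cdot\rangle_\alpha$ be the inner product obtained from $\|\cdot\|_\alpha$ by polarization. $(U,\mu)$ is a fuzzy Hilbert space if $U$ is complete with respect to $\|\cdot\|_\alpha$ for every $\alpha\in(0,1)$. A linear operator $T$ on $U$ is strongly fuzzy bounded if there is $M>0$ with $N(Tx,s)\ge N(x,s/M)$ for all $x\in U,s\in\mathbb R$ (equivalently $\|Tx\|_\alpha\le M\|x\|_\alpha$ for all $x$ and all $\alpha\in(0,1)$, for some $M>0$). Every strongly fuzzy bounded linear operator $T$ on $U$ under consideration is taken to possess an adjoint $T^*$: a strongly fuzzy bounded linear operator on $U$ with $\langle x,Ty\rangle_\alpha=\langle T^*x,y\rangle_\alpha$ for all $x,y\in U$ and all $\alpha\in(0,1)$. For a strongly fuzzy bounded linear operator $K$ on $U$, a sequence $\{f_i\}_{i=1}^\infty$ in $U$ is a fuzzy $K$-frame for $U$ if there are constants $0<A\le B<\infty$ with $A\|K^*f\|_\alpha^2\le\sum_{i=1}^\infty|\langle f,f_i\rangle_\alpha|^2\le B\|f\|_\alpha^2$ for all $f\in U$ and all $\alpha\in(0,1)$. *)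

(* Defs.v *)
From HB Require Import structures.
From mathcomp Require Import all_boot all_order all_algebra.
From mathcomp Require Import all_classical all_reals all_analysis.
From mathcomp Require Import complex.

Set Implicit Arguments.
Unset Strict Implicit.
Unset Printing Implicit Defensive.

Import Order.TTheory GRing.Theory Num.Theory.
Import numFieldNormedType.Exports.

Local Open Scope classical_set_scope.
Local Open Scope ring_scope.
Local Open Scope complex_scope.

Section FuzzyInnerProduct.
Variables (R : realType) (U : lmodType R[i]).
Implicit Types (mu : U -> U -> R[i] -> R) (x y z : U) (s t c : R[i]).

(* On [R[i]] the order is the partial one, so [0 < t] says that [t] is real
   and positive; [`|t|] is the modulus, seen as an element of [R[i]]. *)
Record is_fuzzy_inner_product mu : Prop := IsFuzzyInnerProduct {
  fip_range : forall x y t, 0 <= mu x y t <= 1;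
  fip1 : forall x y z s t,
    Num.min (mu x z `|t|) (mu y z `|s|) <= mu (x + y) z (`|t| + `|s|);
  fip2 : forall x y s t,
    Num.min (mu x x (`|s| ^+ 2)) (mu y y (`|t| ^+ 2)) <= mu x y `|s * t|;
  fip3 : forall x y t, mu x y t = mu y x (t^*);
  fip4 : forall x y t c, c != 0 -> mu (c *: x) y t = mu x y (t / `|c|);
  fip5 : forall x t, ~~ (0 < t) -> mu x x t = 0;
  fip6 : forall x, (forall r : R, 0 < r -> mu x x r%:C = 1) <-> x = 0;
  fip7_mono : forall x, {homo (fun r : R => mu x x r%:C) : r q / r <= q};
  fip7_lim : forall x, mu x x r%:C @[r --> +oo] --> (1 : R)
}.

Definition fuzzy_norm mu x (r : R) : R :=
  if 0 < r then mu x x (r ^+ 2)%:C else 0.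

Definition fip8 mu : Prop :=
  forall x, (forall r : R, 0 < r -> 0 < mu x x (r ^+ 2)%:C) -> x = 0.

Definition alpha_norm mu (alpha : R) x : R :=
  inf [set r : R | 0 < r /\ alpha <= fuzzy_norm mu x r].

Definition fip9 mu : Prop :=
  forall alpha : R, 0 < alpha < 1 -> forall x y,
    alpha_norm mu alpha (x + y) ^+ 2 + alpha_norm mu alpha (x - y) ^+ 2 =
    2 * (alpha_norm mu alpha x ^+ 2 + alpha_norm mu alpha y ^+ 2).

(* Polarization, with the inner product linear in its first argument. *)
Definition alpha_inner mu (alpha : R) x y : R[i] :=
  ((alpha_norm mu alpha (x + y) ^+ 2 - alpha_norm mu alpha (x - y) ^+ 2) / 4)
  +i* ((alpha_norm mu alpha (x + (0 +i* 1) *: y) ^+ 2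
        - alpha_norm mu alpha (x - (0 +i* 1) *: y) ^+ 2) / 4).

Definition alpha_cauchy mu (alpha : R) (u : nat -> U) : Prop :=
  forall e : R, 0 < e -> exists n0 : nat, forall m n : nat,
    (n0 <= m)%N -> (n0 <= n)%N -> alpha_norm mu alpha (u m - u n) < e.

Definition alpha_complete mu (alpha : R) : Prop :=
  forall u : nat -> U, alpha_cauchy mu alpha u ->
    exists x, alpha_norm mu alpha (u n - x) @[n --> \oo] --> (0 : R).

Record is_fuzzy_hilbert mu : Prop := IsFuzzyHilbert {
  fhilb_fip : is_fuzzy_inner_product mu;
  fhilb_fip8 : fip8 mu;
  fhilb_fip9 : fip9 mu;
  fhilb_complete : forall alpha : R, 0 < alpha < 1 -> alpha_complete mu alpha
}.

Definition strongly_fuzzy_bounded mu (T : U -> U) : Prop :=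
  exists2 M : R, 0 < M &
    forall x (r : R), fuzzy_norm mu x (r / M) <= fuzzy_norm mu (T x) r.

Definition is_fuzzy_adjoint mu (T Ts : {linear U -> U}) : Prop :=
  strongly_fuzzy_bounded mu Ts /\
  forall alpha : R, 0 < alpha < 1 -> forall x y,
    alpha_inner mu alpha x (T y) = alpha_inner mu alpha (Ts x) y.

(* The sum is taken in [\bar R]; [Normc.normc] is the real-valued modulus.
   On a fuzzy Hilbert space [K] has at most one adjoint, so [Ks] is K^*. *)
Definition is_fuzzy_K_frame mu (K : {linear U -> U}) (f : nat -> U) : Prop :=
  exists2 Ks : {linear U -> U}, is_fuzzy_adjoint mu K Ks &
  exists A B : R, [/\ 0 < A, A <= B &
    forall alpha : R, 0 < alpha < 1 -> forall g : U,
      ((A * alpha_norm mu alpha (Ks g) ^+ 2)%:E <=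
        \sum_(0 <= i <oo) (Normc.normc (alpha_inner mu alpha g (f i)) ^+ 2)%:E)%E
      /\
      (\sum_(0 <= i <oo) (Normc.normc (alpha_inner mu alpha g (f i)) ^+ 2)%:E <=
        (B * alpha_norm mu alpha g ^+ 2)%:E)%E].

End FuzzyInnerProduct.

(* Main.v *)
Require Import Defs.
From mathcomp Require Import all_boot all_order all_algebra.
From mathcomp Require Import all_classical all_reals all_analysis.
From mathcomp Require Import complex.
From mathcomp Require Import ring lra.
Import Order.TTheory GRing.Theory Num.Theory.
Local Open Scope ring_scope.

(** FIP1 and the Cauchy-Schwarz axiom FIP2 make each alpha-norm subadditive, so
the perturbation hypothesis gives ‖K2* g‖ <= C ‖K1* g‖ with
C = (1 + lambda1) / (1 - lambda2) >= 1, and the frame bounds (A, B) for K1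
become (A / C^2, B) for K2.  The adjoint of K1 carried by the frame need not
a priori be [K1s], but polarization together with the parallelogram law
shows that two adjoints have the same alpha-norms. *)

Section AlphaNorm.
Variables (R : realType) (U : lmodType R[i]) (mu : U -> U -> R[i] -> R).

Lemma alpha_norm_ge0 (alpha : R) (x : U) : 0 <= alpha_norm mu alpha x.
Proof.
(* [inf] of the empty set is 0 by convention; otherwise 0 is a lower bound. *)
have [S0|/set0P S0] := eqVneq
  [set r : R | 0 < r /\ alpha <= fuzzy_norm mu x r]%classic set0%classic.
  by rewrite /alpha_norm S0 inf0.
by apply: lb_le_inf => // r [/ltW].
Qed.

Section Subadditivity.
Hypothesis mu_fip : is_fuzzy_inner_product mu.

(** Mirrors the expansion of ⟨x+y, x+y⟩: FIP1 in each argument splits (s+t)^2 into s^2, st, st, t^2,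
    and FIP2 controls the two cross terms at st. *)
Lemma fuzzy_normD (x y : U) (s t : R) : 0 < s -> 0 < t ->
  Num.min (fuzzy_norm mu x s) (fuzzy_norm mu y t) <=
  fuzzy_norm mu (x + y) (s + t).
Proof.
move=> s0 t0; rewrite /fuzzy_norm s0 t0 addr_gt0//.
have abs_pos (r : R) : 0 < r -> `|r%:C%C| = r%:C%C.
  by move=> r0; rewrite ger0_norm// lecR ltW.
have addP (u v z : U) (p q : R) : 0 < p -> 0 < q ->
    Num.min (mu u z p%:C%C) (mu v z q%:C%C) <= mu (u + v) z (p + q)%:C%C.
  move=> p0 q0; have := fip1 mu_fip u v z q%:C%C p%:C%C.
  by rewrite !abs_pos// rmorphD /=.
have symP (u v : U) (p : R) : mu u v p%:C%C = mu v u p%:C%C.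
  by rewrite (fip3 mu_fip) /= oppr0.
have CS : Num.min (mu x x (s ^+ 2)%:C%C) (mu y y (t ^+ 2)%:C%C) <=
    mu x y (s * t)%:C%C.
  have := fip2 mu_fip x y s%:C%C t%:C%C.
  by rewrite -rmorphM /= !abs_pos ?mulr_gt0// -!rmorphXn.
set m := Num.min _ _.
have -> : (s + t) ^+ 2 = (s ^+ 2 + s * t) + (s * t + t ^+ 2) by ring.
have st0 : 0 < s * t by rewrite mulr_gt0.
have s20 : 0 < s ^+ 2 by rewrite exprn_gt0.
have t20 : 0 < t ^+ 2 by rewrite exprn_gt0.
apply: le_trans (addP _ _ _ _ _ _ _); rewrite ?addr_gt0// le_min.
apply/andP; split; rewrite symP;
  apply: le_trans (addP _ _ _ _ _ _ _) => //; rewrite le_min;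
  apply/andP; split => //; rewrite /m ?ge_min ?lexx ?orbT//.
(* What remains is the cross term [mu y x]; symmetry reduces it to [CS]. *)
by rewrite -ge_min (symP y x).
Qed.

Lemma alpha_norm_set_neq0 (alpha : R) (x : U) : alpha < 1 ->
  ([set r : R | 0 < r /\ alpha <= fuzzy_norm mu x r] !=set0)%classic.
Proof.
move=> alpha1.
have := cvgr_ge _ (fip7_lim mu_fip x) _ alpha1.
move=> [M [_ HM]].
(* This choice gives r >= 1, hence r^2 >= r > M, beyond which [mu x x] is at least [alpha]. *)
pose r := `|M| + 1.
have r1 : 1 <= r by rewrite /r lerDr.
exists r; split; first by lra.
rewrite /fuzzy_norm (lt_le_trans ltr01)//; apply: HM.
have Mr : M < r by rewrite /r; have := ler_norm M; lra.
by rewrite expr2; nra.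
Qed.

(** If s and t are admissible for x and y, then s + t is admissible for x + y by [fuzzy_normD]; take
    the infimum over s, then over t. *)
Lemma alpha_normD (alpha : R) (x y : U) : alpha < 1 ->
  alpha_norm mu alpha (x + y) <= alpha_norm mu alpha x + alpha_norm mu alpha y.
Proof.
move=> alpha1.
have lbS z : has_lbound [set r : R | 0 < r /\ alpha <= fuzzy_norm mu z r]%classic.
  by exists 0 => r [/ltW].
rewrite -lerBlDr; apply: lb_le_inf; first exact: alpha_norm_set_neq0.
move=> s [s0 sx]; rewrite lerBlDr -lerBlDl.
apply: lb_le_inf; first exact: alpha_norm_set_neq0.
move=> t [t0 ty]; rewrite lerBlDl.
apply: ge_inf => //; split; first exact: addr_gt0.
by apply: le_trans (fuzzy_normD _ _ _ _ s0 t0); rewrite le_min sx.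
Qed.

End Subadditivity.

Section Parallelogram.
Hypothesis mu_fip9 : fip9 mu.
Variable alpha : R.
Hypothesis alpha01 : 0 < alpha < 1.

Lemma alpha_norm0 : alpha_norm mu alpha 0 = 0.
Proof.
(* At (0, 0) the parallelogram law reads 2n^2 = 4n^2. *)
have := mu_fip9 alpha alpha01 0 0; rewrite addr0 subr0 => h.
by apply/eqP; rewrite -sqrf_eq0; apply/eqP; lra.
Qed.

Lemma sqr_alpha_norm_double (x : U) :
  alpha_norm mu alpha (x + x) ^+ 2 = 4 * alpha_norm mu alpha x ^+ 2.
Proof.
have := mu_fip9 alpha alpha01 x x; rewrite subrr alpha_norm0 => h.
by lra.
Qed.

Lemma sqr_alpha_normN (x : U) :
  alpha_norm mu alpha (- x) ^+ 2 = alpha_norm mu alpha x ^+ 2.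
Proof.
have := mu_fip9 alpha alpha01 0 x; rewrite add0r sub0r alpha_norm0 => h.
by lra.
Qed.

(** Testing at y = a and y = b, the real parts identify both 4‖a‖^2 and 4‖b‖^2 with ‖a+b‖^2 -
    ‖a-b‖^2. *)
Lemma sqr_alpha_norm_eq (a b : U) :
  (forall y, alpha_inner mu alpha a y = alpha_inner mu alpha b y) ->
  alpha_norm mu alpha a ^+ 2 = alpha_norm mu alpha b ^+ 2.
Proof.
move=> ab.
have := congr1 (@complex.Re R) (ab a); have := congr1 (@complex.Re R) (ab b).
rewrite /alpha_inner /= !subrr !sqr_alpha_norm_double !alpha_norm0.
by rewrite [b + a]addrC -[b - a]opprB sqr_alpha_normN; lra.
Qed.

End Parallelogram.
End AlphaNorm.

Theorem theorem5p1 (R : realType) (U : lmodType R[i])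
    (mu : U -> U -> R[i] -> R) (K1 K2 K1s K2s : {linear U -> U})
    (f : nat -> U) (lambda1 lambda2 : R)
    (hU : is_fuzzy_hilbert mu)
    (hK1 : strongly_fuzzy_bounded mu K1)
    (hK2 : strongly_fuzzy_bounded mu K2)
    (hK1s : is_fuzzy_adjoint mu K1 K1s)
    (hK2s : is_fuzzy_adjoint mu K2 K2s)
    (hf : is_fuzzy_K_frame mu K1 f)
    (hlambda1 : 0 <= lambda1)
    (hlambda2 : 0 <= lambda2)
    (hlambda2_lt1 : lambda2 < 1)
    (hpert : forall g : U, forall alpha : R, 0 < alpha < 1 ->
       alpha_norm mu alpha (K1s g - K2s g) <=
       lambda1 * alpha_norm mu alpha (K1s g)
       + lambda2 * alpha_norm mu alpha (K2s g)) :
  is_fuzzy_K_frame mu K2 f.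
Proof.
have [mu_fip _ mu_fip9 _] := hU.
have [K1s' [_ adj1'] [A [B [A0 AB hAB]]]] := hf.
have [_ adj1] := hK1s.
exists K2s => //.
set C := (1 + lambda1) / (1 - lambda2).
have C1 : 1 <= C by rewrite /C ler_pdivlMr; lra.
have C0 : 0 <= C by rewrite (le_trans ler01).
have C20 : 0 < C ^+ 2 by rewrite exprn_gt0// (lt_le_trans ltr01).
exists (A / C ^+ 2), B; split.
- exact: divr_gt0.
(* Since C >= 1, A / C^2 <= A <= B. *)
- apply: le_trans AB; rewrite ler_pdivrMr// ler_peMr ?(ltW A0)//.
  by rewrite expr2; nra.
move=> alpha alpha01 g; have [lo hi] := hAB alpha alpha01 g.
split; last exact: hi.
apply: le_trans lo; rewrite lee_fin.
have <- : alpha_norm mu alpha (K1s g) ^+ 2 = alpha_norm mu alpha (K1s' g) ^+ 2.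
  apply: (sqr_alpha_norm_eq _ _ _ mu_fip9 _ alpha01) => y.
  by rewrite -adj1 -?adj1'.
rewrite -mulrA ler_pM2l// mulrC ler_pdivrMr// mulrC -exprMn.
rewrite ler_pXn2r ?nnegrE ?alpha_norm_ge0 ?(mulr_ge0 C0) ?alpha_norm_ge0//.
have /andP[_ alpha1] := alpha01.
(* The triangle inequality produces the difference opposite to the one in [hpert]; evenness of the
   norm follows from that of its square. *)
have normBC : alpha_norm mu alpha (K2s g - K1s g) =
    alpha_norm mu alpha (K1s g - K2s g).
  apply/eqP; rewrite -(@eqrXn2 _ 2) ?alpha_norm_ge0//.
  by rewrite -[K2s g - _]opprB sqr_alpha_normN.
(* With [hpert] this yields (1 - lambda2)‖K2s g‖ <= (1 + lambda1)‖K1s g‖, and 1 - lambda2 > 0. *)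
have := alpha_normD _ _ _ mu_fip _ (K2s g - K1s g) (K1s g) alpha1.
rewrite subrK normBC => tri; have := hpert g _ alpha01.
rewrite /C mulrAC ler_pdivlMr; lra.
Qed.
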